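(* Let $G_1$ be an $r_1$-regular graph on $n_1$ vertices and $m_1$ edges, and let $G_2$ be a graph on $n_2$ vertices. Let $\lambda_1(A_{\alpha}(G_1))\ge \lambda_2(A_{\alpha}(G_1))\ge\dots\ge\lambda_{n_1}(A_{\alpha}(G_1))$ be the eigenvalues of $A_{\alpha}(G_1)$. Then for each $\alpha\in[0,1]$, the $A_{\alpha}$-characteristic polynomial of the subdivision-vertex join $G_1 \dot{\vee} G_2$ is \begin{multline*} \psi_{A_{\alpha}(G_1 \dot{\vee} G_2)}(x) =(x-2\alpha)^{m_1 -n_1} \cdot \psi_{A_{\alpha}(G_2)}(x- \alpha n_1)\\ \cdot \prod_{i=2}^{n_1}\bigg( x^2 -\alpha (2+ r_1 + n_2)x + \alpha (\alpha r_1 +r_1+2 \alpha n_2) -(1- \alpha)\Big( (1-\alpha)r_1 + \lambda_i\big(A_{\alpha}(G_1)\big) \Big) \bigg)\\ \cdot \bigg( x^2 -\alpha (2+r_1+n_2)x -2(r_1-2\alpha r_1 -\alpha^2 n_2) -n_1(1-\alpha)^2(x-2\alpha) \Gamma_{A_{\alpha}(G_2)}(x-\alpha n_1) \bigg). \end{multline*}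
   Context: All graphs are simple, undirected, finite and connected. For a graph $G$ with adjacency matrix $A(G)$ and diagonal degree matrix $D(G)$, and $\alpha\in[0,1]$, $A_{\alpha}(G)=\alpha D(G)+(1-\alpha)A(G)$. For a square matrix $M$ of order $n$, $\psi_M(x)=\det(xI_n-M)$ is its characteristic polynomial, and the $M$-coronal is $\Gamma_M(x)=\mathbf{1}_n^T(xI_n-M)^{-1}\mathbf{1}_n$, where $\mathbf{1}_n$ is the all-ones column vector (a rational function of $x$). The subdivision graph $S(G)$ is obtained from $G$ by inserting a new vertex into every edge (replacing each edge by a path on 3 vertices). The subdivision-vertex join $G_1 \dot{\vee} G_2$ is the graph obtained from $S(G_1)$ and $G_2$ by joining every original vertex of $G_1$ (i.e. every vertex of $V(G_1)$) with every vertex of $G_2$. The identity is an identity of rational functions in $x$ (the exponent $m_1-n_1$ may be negative). *)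

(* Defs.v *)
From mathcomp Require Import all_boot all_order all_algebra.

Set Implicit Arguments.
Unset Strict Implicit.
Unset Printing Implicit Defensive.

Import Order.TTheory GRing.Theory Num.Theory.

Record sgraph := SGraph {
  vertex :> finType;
  adj : rel vertex;
  adj_sym : symmetric adj;
  adj_irr : irreflexive adj }.

Definition degree (G : sgraph) (v : G) : nat := #|[set w | adj v w]|.

Definition regular (G : sgraph) (r : nat) : Prop := forall v : G, degree v = r.

(* A connected graph has at least one vertex. *)
Definition connected_graph (G : sgraph) : Prop :=
  (0 < #|G|)%N /\ forall u v : G, connect (@adj G) u v.

Definition edges (G : sgraph) : {set {set G}} :=
  [set e : {set G} | [exists u, exists v, adj u v && (e == [set u; v])]].

Definition edge (G : sgraph) : finType := {e : {set G} | e \in edges G}.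

Section Subdivision.
Variable G : sgraph.

(* [inl v] is an original vertex, [inr e] the vertex inserted into [e]. *)
Definition subdiv_adj (u v : G + edge G) : bool :=
  match u, v with
  | inl x, inr e => x \in val e
  | inr e, inl x => x \in val e
  | _, _ => false
  end.

Lemma subdiv_adj_sym : symmetric subdiv_adj.
Proof. by case=> [x|e] [y|f]. Qed.

Lemma subdiv_adj_irr : irreflexive subdiv_adj.
Proof. by case. Qed.

Definition subdivision : sgraph := SGraph subdiv_adj_sym subdiv_adj_irr.

Definition original (u : subdivision) : bool :=
  match u : G + edge G with inl _ => true | inr _ => false end.
End Subdivision.

Section SubdivisionVertexJoin.
Variables G1 G2 : sgraph.

Definition svjoin_adj (u v : subdivision G1 + G2) : bool :=
  match u, v with
  | inl x, inl y => adj x y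
  | inr x, inr y => adj x y
  | inl x, inr _ => original x
  | inr _, inl y => original y
  end.

Lemma svjoin_adj_sym : symmetric svjoin_adj.
Proof. by case=> [x|x] [y|y] //; [exact: (adj_sym x y) | exact: (adj_sym x y)]. Qed.

Lemma svjoin_adj_irr : irreflexive svjoin_adj.
Proof. by case=> x; exact: (adj_irr x). Qed.

Definition svjoin : sgraph := SGraph svjoin_adj_sym svjoin_adj_irr.
End SubdivisionVertexJoin.

Local Open Scope ring_scope.

(* Rows and columns follow the enumeration [enum_val] of the vertices. *)
Definition adj_mx (R : nzRingType) (G : sgraph) : 'M[R]_#|G| :=
  \matrix_(i, j) (adj (enum_val i) (enum_val j))%:R.

Definition deg_mx (R : nzRingType) (G : sgraph) : 'M[R]_#|G| :=
  diag_mx (\row_i (degree (enum_val i))%:R).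

Definition A_alpha (R : nzRingType) (alpha : R) (G : sgraph) : 'M[R]_#|G| :=
  alpha *: deg_mx R G + (1 - alpha) *: adj_mx R G.

(* [lam 1 >= ... >= lam n] are the eigenvalues of [M], repeated according to
   their multiplicities as roots of the characteristic polynomial; the other
   values of [lam] are irrelevant. *)
Definition ordered_eigenvalues (R : numDomainType) (n : nat) (M : 'M[R]_n)
    (lam : nat -> R) : Prop :=
  (forall i j : nat, (1 <= i)%N -> (i <= j)%N -> (j <= n)%N ->
     lam j <= lam i) /\
  char_poly M = \prod_(1 <= i < n.+1) ('X - (lam i)%:P).

Notation ratfun R := {fraction {poly R}}.

Section RationalFunctions.
Variable R : idomainType.

Definition ratC (a : R) : ratfun R := tofrac a%:P.

Definition ratX : ratfun R := tofrac 'X.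

(* Characteristic polynomial and coronal of [M] with the rational function [y]
   substituted for the variable; the coronal is meaningful when [y] is not an
   eigenvalue of [M], in particular for every nonconstant [y] when [R] is a
   field, such a [y] being transcendental over [R]. *)
Definition psi (n : nat) (M : 'M[R]_n) (y : ratfun R) : ratfun R :=
  (map_poly ratC (char_poly M)).[y].

Definition coronal (n : nat) (M : 'M[R]_n) (y : ratfun R) : ratfun R :=
  ((const_mx 1 : 'cV[ratfun R]_n)^T *m invmx (y%:M - map_mx ratC M)
     *m (const_mx 1 : 'cV[ratfun R]_n)) 0 0.
End RationalFunctions.

Arguments ratX {R}.

(* Main.v *)
(* With [b = 1 - a] and [t = x - 2a], the Schur complement of the subdivision
   and [G2] blocks of [x - A_alpha] is [1/t] times
   [z - b A_alpha(G1) - t b^2 Gamma J] for a scalar [z], because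
   [b B B^T = b (r1 + A(G1)) = A_alpha(G1) + (b - a) r1] for the incidence
   matrix [B].  The all-ones vector is an eigenvector of [A_alpha(G1)] for [r1],
   so the multiple of [J] only changes the factor of the determinant belonging
   to this eigenvalue.  That factor is the one indexed by 1, as [r1] bounds all
   eigenvalues: the entries are nonnegative with column sums [r1]. *)
From HB Require Import structures.
Require Import Defs.
From mathcomp Require Import all_boot all_order all_algebra.
From mathcomp Require Import fingroup perm ring.
Set Implicit Arguments.
Unset Strict Implicit.
Unset Printing Implicit Defensive.
Import Order.TTheory GRing.Theory Num.Theory.
Local Open Scope ring_scope.

(** * Determinants of bordered, rank-one perturbed and reindexed matrices *)

Lemma horner_char_poly (R : comNzRingType) n (M : 'M[R]_n) (y : R) :
  (char_poly M).[y] = \det (y%:M - M).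
Proof.
rewrite -horner_evalE -det_map_mx map_mxB map_scalar_mx /= horner_evalE hornerX.
by congr (\det (_ - _)); apply/matrixP=> i j; rewrite !mxE horner_evalE hornerC.
Qed.

(** Reindexing rows and columns by the same permutation multiplies by its sign twice. The sizes [m]
    and [n] are kept apart because the vertices of [svjoin] are counted by [#|svjoin G1 G2|] on one
    side and by a sum of block sizes on the other. *)
Lemma det_mxsub_inj (R : comPzRingType) m n (f : 'I_m -> 'I_n) (A : 'M[R]_n) :
  m = n -> injective f -> \det (mxsub f f A) = \det A.
Proof.
move=> emn; subst n => injf.
have -> : mxsub f f A = row_perm (perm injf) (col_perm (perm injf) A).
  by apply/matrixP=> i j; rewrite !mxE !permE.
rewrite row_permE col_permE !det_mulmx mulrC -mulrA -det_mulmx.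
by rewrite -perm_mxM mulVg perm_mx1 det1 mulr1.
Qed.

(** Block Gaussian elimination: the matrix is an upper block triangular one times a lower
    unitriangular one. Taking the inverse of [D] as a parameter allows an explicit block diagonal
    [D']. *)
Lemma det_schur (R : comPzRingType) n k (A : 'M[R]_n) (B : 'M_(n, k)) C D D' :
  D *m D' = 1%:M ->
  \det (block_mx A B C D) = \det D * \det (A - B *m D' *m C).
Proof.
move=> DD'.
have -> : block_mx A B C D
    = block_mx (A - B *m D' *m C) B 0 D *m block_mx 1%:M 0 (D' *m C) 1%:M.
  rewrite mulmx_block !mulmx1 !mulmx0 !add0r.
  by rewrite !mulmxA DD' mul1mx subrK.
by rewrite det_mulmx det_ublock det_lblock !det1 !mulr1 mulrC.
Qed.

Lemma det_1B_rank1 (R : comPzRingType) n (u : 'cV[R]_n) (v : 'rV_n) :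
  \det (1%:M - u *m v) = 1 - (v *m u) 0 0.
Proof.
(* The bordered matrix is evaluated twice: eliminating the upper left block gives the scalar,
   eliminating the lower right one gives [1%:M - u *m v]. *)
have -> : 1 - (v *m u) 0 0 = \det (block_mx 1%:M u v 1%:M).
  have -> : block_mx 1%:M u v 1%:M
    = block_mx 1%:M 0 v 1%:M *m block_mx 1%:M u 0 (1%:M - v *m u) :> 'M_(n + 1).
    rewrite mulmx_block !mulmx1 !mulmx0 !mul0mx !mul1mx !addr0.
    by rewrite addrC subrK.
  by rewrite det_mulmx det_ublock det_lblock !det1 !mul1r det_mx11 !mxE eqxx.
by rewrite (det_schur _ _ _ (mulmx1 1%:M)) det1 mul1r mulmx1.
Qed.

(* Since [Z] maps the all-ones vector to [mu] times itself, [Z] minus the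
   constant matrix [c] factors as [Z *m (1 - (c / mu) *: J)]. *)
Lemma det_sub_const_mx (F : fieldType) n (Z : 'M[F]_n) (mu c : F) :
  mu != 0 -> Z *m const_mx 1 = mu *: (const_mx 1 : 'cV_n) ->
  mu * \det (Z - const_mx c) = (mu - n%:R * c) * \det Z.
Proof.
move=> mu0 Zu.
have -> : Z - const_mx c
    = Z *m (1%:M - (const_mx 1 : 'cV_n) *m (const_mx (c / mu) : 'rV_n)).
  rewrite mulmxBr mulmx1 mulmxA Zu -scalemxAl; congr (_ - _).
  apply/matrixP=> i j; rewrite !mxE big_ord1 !mxE; field.
  by rewrite mu0.
rewrite det_mulmx det_1B_rank1.
have -> : ((const_mx (c / mu) : 'rV_n) *m (const_mx 1 : 'cV_n)) 0 0 = n%:R * (c / mu).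
  rewrite !mxE (eq_bigr (fun=> c / mu)) ?sumr_const ?card_ord ?mulr_natl //.
  by move=> k _; rewrite !mxE mulr1.
by field.
Qed.

Lemma det_scalar_subZ (F : fieldType) n (M : 'M[F]_n) (b z : F) (lam : nat -> F) :
  char_poly M = \prod_(1 <= i < n.+1) ('X - (lam i)%:P) ->
  \det (z%:M - b *: M) = \prod_(1 <= i < n.+1) (z - b * lam i).
Proof.
(* The other case evaluates [char_poly M] at [z / b]; here [b] vanishes when [alpha] is 1. *)
move=> chM; have [->|b0] := eqVneq b 0.
  rewrite scale0r subr0 det_scalar (eq_bigr (fun=> z)).
    by rewrite prodr_const_nat subSS subn0.
  by move=> i _; rewrite mul0r subr0.
have -> : z%:M - b *: M = b *: ((z / b)%:M - M).
  by rewrite scalerBr scale_scalar_mx mulrC divfK.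
rewrite detZ -horner_char_poly chM horner_prod.
have -> : b ^+ n = \prod_(1 <= i < n.+1) b by rewrite prodr_const_nat subSS subn0.
rewrite -big_split /=; apply: eq_bigr => i _.
by rewrite !hornerE mulrBr mulrC divfK.
Qed.

(** * Characteristic polynomials at rational functions *)

HB.instance Definition _ (R : idomainType) :=
  GRing.RMorphism.copy (@ratC R) (@tofrac _ \o @polyC R).

Lemma psi_det (R : idomainType) n (M : 'M[R]_n) (y : ratfun R) :
  psi M y = \det (y%:M - map_mx (@ratC R) M).
Proof. by rewrite /psi map_char_poly horner_char_poly. Qed.

Lemma psi_tofrac (R : idomainType) n (M : 'M[R]_n) (q : {poly R}) :
  psi M (tofrac q) = tofrac (char_poly M \Po q).
Proof.
rewrite /psi /comp_poly -horner_map -map_poly_comp.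
by congr (_.[_]).
Qed.

(** * Counting edges through one or two given vertices *)

Lemma sum_enum_val (V : nmodType) (T : finType) (f : T -> V) :
  \sum_(i < #|T|) f (enum_val i) = \sum_t f t.
Proof. by rewrite -(big_enum_val (A := T)); apply: eq_bigl. Qed.

Lemma degreeE (G : sgraph) (v : G) : degree v = (\sum_w adj v w)%N.
Proof. by rewrite /degree -sum1dep_card big_mkcond; apply: eq_bigr => w _; case: ifP. Qed.

Lemma edgesP (G : sgraph) (e : {set G}) :
  reflect (exists u v, adj u v /\ e = [set u; v]) (e \in edges G).
Proof.
rewrite inE; apply: (iffP existsP) => [[u /existsP[v /andP[uv /eqP->]]]|].
  by exists u, v.
by move=> [u [v [uv ->]]]; exists u; apply/existsP; exists v; rewrite uv eqxx.
Qed.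

Lemma card_edge (G : sgraph) (e : {set G}) : e \in edges G -> #|e| = 2%N.
Proof.
move=> /edgesP[u [v [uv ->]]]; rewrite cards2.
by case: eqVneq uv => // <-; rewrite adj_irr.
Qed.

Lemma edge_set2 (G : sgraph) (u v : G) : ([set u; v] \in edges G) = adj u v.
Proof.
apply/edgesP/idP => [[x [y [xy E]]]|uv]; last by exists u, v.
have [ux vx] : u \in [set x; y] /\ v \in [set x; y] by rewrite -E set21 set22.
(* Distinctness excludes the cases where [u] and [v] are the same endpoint of the edge. *)
have: u != v.
  have: #|[set u; v]| = 2%N.
    by rewrite E cards2; case: eqVneq xy => // <-; rewrite adj_irr.
  by rewrite cards2; case: eqP.
move: ux vx; rewrite !inE => /orP[]/eqP-> /orP[]/eqP->; rewrite ?eqxx //.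
by rewrite adj_sym.
Qed.

(** Sending a neighbour [w] of [v] to [[set v; w]] is a bijection onto the edges through [v]. *)
Lemma card_edges_at (G : sgraph) (v : G) : #|[set e in edges G | v \in e]| = degree v.
Proof.
have injv : {in [set w | adj v w] &, injective (fun w => [set v; w])}.
  move=> x y; rewrite !inE => vx vy E.
  have: x \in [set v; y] by rewrite -E set22.
  by rewrite !inE => /orP[/eqP xv|/eqP//]; rewrite xv adj_irr in vx.
rewrite /degree -(card_in_imset injv); apply: eq_card => e; rewrite in_set /=.
apply/andP/imsetP => [[/edgesP[x [y [xy ->]]]]|[w]].
  rewrite !inE => /orP[]/eqP->; first by exists y; rewrite ?inE.
  by exists x; rewrite ?inE 1?adj_sym // setUC.
by rewrite inE => vw ->; rewrite edge_set2 vw set21.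
Qed.

(** An edge has two elements, so only [[set u; v]] can contain both vertices: the set counted is a
    singleton or empty. *)
Lemma card_edges_at2 (G : sgraph) (u v : G) :
  u != v -> #|[set e in edges G | (u \in e) && (v \in e)]| = adj u v.
Proof.
move=> uv; rewrite -edge_set2.
have -> : [set e in edges G | (u \in e) && (v \in e)]
    = if [set u; v] \in edges G then [set [set u; v]] else set0.
  apply/setP=> e; rewrite in_set; have [eE|eE] /= := boolP (e \in edges G).
    have -> : (u \in e) && (v \in e) = (e == [set u; v]).
      rewrite eq_sym eqEcard (card_edge eE) cards2 uv andbT.
      by rewrite subUset !sub1set.
    case: ifP => [|uvE]; rewrite ?in_set1 ?in_set0 //.
    by apply/negbTE/eqP => ee; rewrite ee uvE in eE.
  case: ifP; rewrite ?in_set1 ?in_set0 // => uvE; apply/esym/negbTE/eqP => ee.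
  by rewrite ee uvE in eE.
by case: ifP; rewrite ?cards1 ?cards0.
Qed.

Lemma sum_edge (G : sgraph) (P : pred {set G}) :
  (\sum_(e : edge G) P (val e) = #|[set e in edges G | P e]|)%N.
Proof.
rewrite -(big_sub (mem (edges G)) (fun e => nat_of_bool (P e))).
rewrite -sum1dep_card big_mkcondr /=.
by apply: eq_bigr => e _; case: (P e).
Qed.

(** * The vertex-edge incidence matrix *)

Definition inc_mx (R : pzSemiRingType) (G : sgraph) : 'M[R]_(#|G|, #|edge G|) :=
  \matrix_(i < #|G|, j < #|edge G|) (enum_val i \in val (enum_val j : edge G))%:R.

(** The entry at two vertices counts the edges through both: the degree on the diagonal, the
    adjacency off it. *)
Lemma inc_mx_mul_tr (R : nzRingType) (G : sgraph) :
  inc_mx R G *m (inc_mx R G)^T = deg_mx R G + adj_mx R G.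
Proof.
apply/matrixP=> i j; rewrite !mxE.
rewrite (eq_bigr (fun k => ((enum_val i \in val (enum_val k : edge G)) &&
    (enum_val j \in val (enum_val k : edge G)))%:R)); last first.
  by move=> k _; rewrite !mxE -natrM mulnb.
rewrite (sum_enum_val (fun e : edge G =>
  ((enum_val i \in val e) && (enum_val j \in val e))%:R)).
rewrite -natr_sum (sum_edge (fun e => (enum_val i \in e) && (enum_val j \in e))).
have [->|ij] := eqVneq i j.
  rewrite adj_irr addr0 -card_edges_at; congr _%:R.
  by apply: eq_card => e; rewrite !inE andbb.
by rewrite card_edges_at2 ?add0r // (inj_eq enum_val_inj).
Qed.

(** * The largest eigenvalue of [A_alpha] for a regular graph *)

Lemma A_alpha_mul_const1 (R : nzRingType) (alpha : R) (G : sgraph) r :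
  regular G r -> A_alpha alpha G *m const_mx 1 = r%:R *: (const_mx 1 : 'cV_#|G|).
Proof.
move=> regG; rewrite mulmxDl -!scalemxAl.
have -> : deg_mx R G *m const_mx 1 = r%:R *: (const_mx 1 : 'cV_#|G|).
  by rewrite mul_diag_mx; apply/matrixP=> i j; rewrite !mxE regG.
have -> : adj_mx R G *m const_mx 1 = r%:R *: (const_mx 1 : 'cV_#|G|).
  apply/matrixP=> i j; rewrite !mxE -(regG (enum_val i)) degreeE natr_sum mulr1.
  rewrite -(sum_enum_val (fun w => (adj (enum_val i) w)%:R)).
  by apply: eq_bigr => k _; rewrite !mxE mulr1.
by rewrite -scalerDl addrC subrK scale1r.
Qed.

Lemma A_alpha_tr (R : nzRingType) (alpha : R) (G : sgraph) :
  (A_alpha alpha G)^T = A_alpha alpha G.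
Proof.
rewrite linearD !linearZ /= tr_diag_mx; congr (_ + _ *: _).
by apply/matrixP=> i j; rewrite !mxE adj_sym.
Qed.

(** The eigenvector equation is compared in absolute value at a coordinate where the eigenvector is
    largest. Column sums occur because [eigenvalue] refers to row eigenvectors. *)
Lemma eigenvalue_le_colsum (R : realFieldType) n (A : 'M[R]_n) (r l : R) :
  (forall i j, 0 <= A i j) -> (forall j, \sum_i A i j <= r) ->
  eigenvalue A l -> l <= r.
Proof.
move=> A0 Ar /eigenvalueP[v vA /rV0Pn[i0 vi0]].
pose j := [arg max_(i > i0) `|v 0 i|]%O.
have vj i : `|v 0 i| <= `|v 0 j| by rewrite /j; case: arg_maxP => // k _; apply.
have vj0 : 0 < `|v 0 j| by apply: lt_le_trans (vj i0); rewrite normr_gt0.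
rewrite (le_trans (ler_norm l)) // -(ler_pM2r vj0) -normrM.
have <- : (v *m A) 0 j = l * v 0 j by rewrite vA mxE.
rewrite mxE (le_trans (ler_norm_sum _ _ _)) //.
apply: le_trans (_ : (\sum_i A i j) * `|v 0 j| <= _); last by rewrite ler_pM2r.
rewrite mulr_suml; apply: ler_sum => i _.
by rewrite normrM mulrC (ger0_norm (A0 _ _)) ler_wpM2l.
Qed.

(** The column sums bound [lam 1] by [r]; conversely [r] is an eigenvalue, hence some [lam i], which
    is at most [lam 1]. *)
Lemma largest_eigenvalue_regular (R : realFieldType) (G : sgraph) r (alpha : R) lam :
  (0 < #|G|)%N -> regular G r -> 0 <= alpha <= 1 ->
  ordered_eigenvalues (A_alpha alpha G) lam -> lam 1%N = r%:R.
Proof.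
move=> G0 regG /andP[a0 a1] [lam_le chA].
have eigP l : eigenvalue (A_alpha alpha G) l =
    (l \in [seq lam i | i <- index_iota 1 #|G|.+1]).
  rewrite eigenvalue_root_char chA.
  by rewrite -(big_map lam xpredT (fun a => 'X - a%:P)) root_prod_XsubC.
apply/eqP; rewrite eq_le; apply/andP; split.
  apply: (@eigenvalue_le_colsum _ _ (A_alpha alpha G)).
  - move=> i j; rewrite !mxE; case: eqP => _; rewrite ?mulr1n ?mulr0n.
      by rewrite addr_ge0 // mulr_ge0 ?subr_ge0.
    by rewrite addr_ge0 // mulr_ge0 ?subr_ge0.
  (* By symmetry the column sums are the row sums, which are the entries of the image of the
     all-ones vector. *)
  - move=> j; have /matrixP/(_ j 0) := A_alpha_mul_const1 alpha regG.
    rewrite !mxE mulr1 => <-.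
    rewrite le_eqVlt; apply/predU1P; left; apply: eq_bigr => i _.
    by rewrite [const_mx 1 _ _]mxE mulr1 -{1}A_alpha_tr mxE.
  by rewrite eigP map_f // mem_index_iota ltnS.
have: eigenvalue (A_alpha alpha G) r%:R.
  rewrite eigenvalue_root_char rootE horner_char_poly.
  (* The all-ones row is nonzero because the graph has a vertex; transposition reduces it to the
     column eigenvector. *)
  apply/det0P; exists (const_mx 1).
    case: #|G| G0 => // n _; apply/eqP => /matrixP/(_ 0 0)/eqP.
    by rewrite !mxE oner_eq0.
  rewrite -[LHS]trmxK trmx_mul linearB /= tr_scalar_mx A_alpha_tr trmx_const.
  by rewrite mulmxBl (A_alpha_mul_const1 _ regG) mul_scalar_mx subrr linear0.
rewrite eigP => /mapP[i]; rewrite mem_index_iota ltnS => /andP[i1 iG] ->.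
exact: lam_le.
Qed.

(** Degrees and adjacencies are natural numbers, so [f] moves only [alpha]. This carries matrices
    over [R] to rational functions. *)
Lemma A_alpha_map (R S : nzRingType) (f : {rmorphism R -> S}) (alpha : R) (G : sgraph) :
  map_mx f (A_alpha alpha G) = A_alpha (f alpha) G.
Proof.
apply/matrixP=> i j.
by rewrite !mxE rmorphD !rmorphM !rmorphMn rmorphB rmorph1.
Qed.

(** * Block form of the matrix of the subdivision-vertex join *)

Section Svjoin.
Variables G1 G2 : sgraph.

Lemma degree_svjoin_vertex (v : G1) :
  degree (inl (inl v) : svjoin G1 G2) = (degree v + #|G2|)%N.
Proof.
rewrite degreeE big_sumType big_sumType /= big1 // add0n sum1_card.
rewrite -card_edges_at -(sum_edge (fun e => v \in e)).
by congr (_ + _)%N.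
Qed.

Lemma degree_svjoin_edge (e : edge G1) : degree (inl (inr e) : svjoin G1 G2) = 2%N.
Proof.
rewrite degreeE big_sumType big_sumType /= ![(\sum_(_ : _) 0)%N]big1 // !addn0.
rewrite -(card_edge (valP e)) -sum1_card [RHS]big_mkcond.
by apply: eq_bigr => v _; case: (v \in val e).
Qed.

Lemma degree_svjoin_join (w : G2) :
  degree (inr w : svjoin G1 G2) = (degree w + #|G1|)%N.
Proof.
rewrite degreeE big_sumType big_sumType /= [X in (_ + X + _)%N]big1 // addn0 addnC.
by rewrite degreeE sum1_card.
Qed.

(** Original vertices come first; inserted vertices and those of [G2] are grouped, since the Schur
    complement eliminates them together. *)
Definition svjoin_index (i : 'I_(#|G1| + (#|edge G1| + #|G2|))) :
    'I_#|svjoin G1 G2| :=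
  enum_rank (match split i with
    | inl j => inl (inl (enum_val j))
    | inr k => match split k with
      | inl e => inl (inr (enum_val e))
      | inr w => inr (enum_val w)
      end
    end : svjoin G1 G2).

Lemma svjoin_index_inj : injective svjoin_index.
Proof.
move=> i j /enum_rank_inj.
case: (split_ordP i) => i1 ->; case: (split_ordP j) => j1 ->.
- by move=> [/enum_val_inj ->].
- by case: (split j1).
- by case: (split i1).
case: (split_ordP i1) => i2 ->; case: (split_ordP j1) => j2 -> //.
  by move=> [/enum_val_inj ->].
by move=> [/enum_val_inj ->].
Qed.

Lemma enum_val_svjoin_vertex j :
  enum_val (svjoin_index (lshift _ j)) = inl (inl (enum_val j)).
Proof.
rewrite enum_rankK; case: split_ordP => k /eqP.
  by rewrite eq_lshift => /eqP ->.
by rewrite eq_lrshift.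
Qed.

Lemma enum_val_svjoin_edge e :
  enum_val (svjoin_index (rshift _ (lshift _ e))) = inl (inr (enum_val e)).
Proof.
rewrite enum_rankK; case: split_ordP => k /eqP;
  rewrite (eq_rshift, eq_rlshift) // => /eqP <-.
by case: split_ordP => l /eqP; rewrite (eq_lshift, eq_lrshift) // => /eqP ->.
Qed.

Lemma enum_val_svjoin_join w :
  enum_val (svjoin_index (rshift _ (rshift _ w))) = inr (enum_val w).
Proof.
rewrite enum_rankK; case: split_ordP => k /eqP;
  rewrite (eq_rshift, eq_rlshift) // => /eqP <-.
by case: split_ordP => l /eqP; rewrite (eq_rshift, eq_rlshift) // => /eqP ->.
Qed.

Lemma card_svjoin : #|svjoin G1 G2| = (#|G1| + (#|edge G1| + #|G2|))%N.
Proof. by rewrite card_sum card_sum addnA. Qed.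

(** Original vertices are pairwise nonadjacent and all of degree [r + #|G2|], which makes the first
    block scalar. Inserted vertices have degree 2 and no neighbour in [G2]. Each vertex of [G2]
    gains [#|G1|] neighbours, whence the shift of [x] in the last block. *)
Lemma svjoin_block (R : comNzRingType) (x a : R) r :
  regular G1 r ->
  mxsub svjoin_index svjoin_index (x%:M - A_alpha a (svjoin G1 G2)) =
  block_mx ((x - a * (r%:R + #|G2|%:R))%:M)
    (row_mx (- (1 - a) *: inc_mx R G1) (const_mx (- (1 - a))))
    (col_mx (- (1 - a) *: (inc_mx R G1)^T) (const_mx (- (1 - a))))
    (block_mx ((x - 2 * a)%:M) 0 0 ((x - a * #|G1|%:R)%:M - A_alpha a G2)).
Proof.
move=> reg1; apply/matrixP=> i j.
have -> : mxsub svjoin_index svjoin_index (x%:M - A_alpha a (svjoin G1 G2)) i j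
   = x *+ (i == j) - (a * ((degree (enum_val (svjoin_index i)))%:R *+ (i == j))
      + (1 - a) * (adj (enum_val (svjoin_index i)) (enum_val (svjoin_index j)))%:R).
  by rewrite !mxE (inj_eq svjoin_index_inj).
case: (split_ordP i) => i1 ->; case: (split_ordP j) => j1 ->;
  rewrite ?block_mxEul ?block_mxEur ?block_mxEdl ?block_mxEdr
    ?eq_lshift ?eq_rshift ?eq_lrshift ?eq_rlshift.
- rewrite !enum_val_svjoin_vertex degree_svjoin_vertex reg1 !mxE natrD.
  by case: eqVneq => _ /=; ring.
- rewrite enum_val_svjoin_vertex; case: (split_ordP j1) => j2 ->.
    rewrite row_mxEl !mxE enum_val_svjoin_edge /=; ring.
  rewrite row_mxEr !mxE enum_val_svjoin_join /=; ring.
- rewrite enum_val_svjoin_vertex; case: (split_ordP i1) => i2 ->.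
    rewrite col_mxEu !mxE enum_val_svjoin_edge /=; ring.
  rewrite col_mxEd !mxE enum_val_svjoin_join /=; ring.
- case: (split_ordP i1) => i2 ->; case: (split_ordP j1) => j2 ->;
    rewrite ?block_mxEul ?block_mxEur ?block_mxEdl ?block_mxEdr
      ?eq_lshift ?eq_rshift ?eq_lrshift ?eq_rlshift
      ?enum_val_svjoin_edge ?enum_val_svjoin_join.
  + rewrite degree_svjoin_edge !mxE /=; case: eqVneq => _ /=; ring.
  + rewrite !mxE /=; ring.
  + rewrite !mxE /=; ring.
  + rewrite degree_svjoin_join !mxE natrD /=; case: eqVneq => _ /=; ring.
Qed.
End Svjoin.

(** * The determinant of the block matrix over any field, with the facts on graphs as hypotheses *)

Lemma det_svjoin_block (F : fieldType) n m p (x a : F) r (lam : nat -> F)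
    (M : 'M[F]_n) (B : 'M_(n, m)) (N : 'M_p) :
  let b := 1 - a in let t := x - 2 * a in
  let W := (x - a * n%:R)%:M - N in
  let mu := t * (x - a * (r + p%:R)) - 2 * b ^+ 2 * r in
  (0 < n)%N -> t != 0 -> W \in unitmx -> mu != 0 ->
  b *: (B *m B^T) = (b * r - a * r)%:M + M ->
  M *m const_mx 1 = r *: (const_mx 1 : 'cV_n) ->
  char_poly M = \prod_(1 <= i < n.+1) ('X - (lam i)%:P) -> lam 1%N = r ->
  \det (block_mx ((x - a * (r + p%:R))%:M)
    (row_mx (- b *: B) (const_mx (- b)))
    (col_mx (- b *: B^T) (const_mx (- b)))
    (block_mx (t%:M) 0 0 W)) =
  t ^ (m%:Z - n%:Z) * \det W
  * (\prod_(2 <= i < n.+1)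
        (x ^+ 2 - a * (2 + r + p%:R) * x
         + a * (a * r + r + 2 * a * p%:R)
         - (1 - a) * ((1 - a) * r + lam i)))
  * (x ^+ 2 - a * (2 + r + p%:R) * x
       - 2 * (r - 2 * a * r - a ^+ 2 * p%:R)
       - n%:R * (1 - a) ^+ 2 * (x - 2 * a)
         * ((const_mx 1 : 'cV_p)^T *m invmx W *m (const_mx 1 : 'cV_p)) 0 0).
Proof.
move=> b t W mu n0 t0 Wu mu0 BB M1 chM lam1.
set g := (_ *m invmx W *m _) 0 0.
pose D' : 'M_(m + p) := block_mx (t^-1)%:M 0 0 (invmx W).
have DD' : block_mx t%:M 0 0 W *m D' = 1%:M.
  rewrite mulmx_block !mulmx0 !mul0mx !addr0 add0r mulmxV //.
  by rewrite mul_scalar_mx scale_scalar_mx divff // -scalar_mx_block.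
rewrite (det_schur _ _ _ DD') det_ublock det_scalar.
(* By [BB], [z] collects the scalar terms of [t] times the Schur complement. On the all-ones vector
   [M] acts as [r], so [z%:M - b *: M] acts there as [mu]. *)
pose z := t * (x - a * (r + p%:R)) - b * (b * r - a * r).
have z_mu : z - b * r = mu by rewrite /z /mu /b; ring.
have -> : (x - a * (r + p%:R))%:M - row_mx (- b *: B) (const_mx (- b)) *m D'
     *m col_mx (- b *: B^T) (const_mx (- b))
   = t^-1 *: (z%:M - b *: M - const_mx (t * b ^+ 2 * g)).
  rewrite mul_row_block !mulmx0 addr0 add0r mul_row_col.
  have -> : const_mx (- b) *m invmx W *m const_mx (- b)
      = const_mx (b ^+ 2 * g) :> 'M_n.
    apply/matrixP=> i j; rewrite /g !mxE [RHS]mulr_sumr; apply: eq_bigr => k _.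
    rewrite !mxE !mulr1 !mulr_suml mulr_sumr; apply: eq_bigr => l _.
    by rewrite !mxE; ring.
  have -> : (- b *: B) *m (t^-1)%:M *m (- b *: B^T) = (t^-1 * b) *: (b *: (B *m B^T)).
    by rewrite mul_mx_scalar -!scalemxAl -scalemxAr !scalerA; congr (_ *: _); ring.
  rewrite BB.
  by apply/matrixP=> i j; rewrite !mxE /z; case: eqVneq => _ /=; field.
have ZZ : (z%:M - b *: M) *m const_mx 1 = mu *: (const_mx 1 : 'cV_n).
  by rewrite mulmxBl mul_scalar_mx -scalemxAl M1 scalerA -scalerBl z_mu.
(* The factor of index 1 in the determinant of [z%:M - b *: M] is [mu]; it cancels against the [mu]
   on the left of [det_sub_const_mx]. *)
rewrite detZ; have /(mulfI mu0) -> : mu * \det (z%:M - b *: M - const_mx (t * b ^+ 2 * g))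
   = mu * ((mu - n%:R * (t * b ^+ 2 * g)) * \prod_(2 <= i < n.+1) (z - b * lam i)).
  rewrite (det_sub_const_mx _ mu0 ZZ) (det_scalar_subZ _ _ chM).
  by rewrite big_ltn // lam1 z_mu; ring.
(* The exponent [m] comes from the block of inserted vertices, and [- n] from the factor [t^-1] of
   the Schur complement. *)
rewrite expfzDr // -exprnP -exprnN -exprVn.
set P := (\prod_(2 <= i < _) _); set Q := (\prod_(2 <= i < _) _).
have -> : P = Q by apply: eq_bigr => i _; rewrite /z /b /t; ring.
have -> : mu - n%:R * (t * b ^+ 2 * g) = x ^+ 2 - a * (2 + r + p%:R) * x
       - 2 * (r - 2 * a * r - a ^+ 2 * p%:R)
       - n%:R * (1 - a) ^+ 2 * (x - 2 * a) * g.
  by rewrite /mu /b /t; ring.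
by ring.
Qed.

(** * Nonvanishing of the rational functions to be inverted or cancelled *)

Lemma psi_neq0 (R : idomainType) n (M : 'M[R]_n) (q : {poly R}) :
  (1 < size q)%N -> psi M (tofrac q) != 0.
Proof.
move=> q1; rewrite psi_tofrac tofrac_eq0 comp_poly_eq0 //.
exact/monic_neq0/char_poly_monic.
Qed.

Lemma ratX_sub_ratC (R : idomainType) (c : R) :
  ratX - ratC c = tofrac ('X - c%:P).
Proof. by rewrite rmorphB. Qed.

Lemma ratX_sub_ratC_neq0 (R : idomainType) (c : R) : ratX - ratC c != 0.
Proof. by rewrite ratX_sub_ratC tofrac_eq0 polyXsubC_eq0. Qed.

(** Subtracting a constant leaves a polynomial of degree 2. The scalar [mu] of [det_svjoin_block]
    has this shape. *)
Lemma ratX_quadratic_neq0 (R : idomainType) (c d e : R) :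
  (ratX - ratC c) * (ratX - ratC d) - ratC e != 0.
Proof.
have -> : (ratX - ratC c) * (ratX - ratC d) - ratC e
    = tofrac (('X - c%:P) * ('X - d%:P) - e%:P).
  by rewrite rmorphB rmorphM !rmorphB.
have sz : size (('X - c%:P) * ('X - d%:P)) = 3%N.
  by rewrite size_Mmonic ?polyXsubC_eq0 ?monicXsubC // !size_XsubC.
rewrite tofrac_eq0 -size_poly_gt0 size_polyDl sz // size_polyN.
by rewrite (leq_ltn_trans (size_polyC_leq1 _)).
Qed.

Theorem theorem1 (R : rcfType) (G1 G2 : sgraph) (n1 m1 n2 r1 : nat)
    (hG1 : connected_graph G1) (hG2 : connected_graph G2)
    (hn1 : #|G1| = n1) (hm1 : #|edges G1| = m1) (hn2 : #|G2| = n2)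
    (hr1 : regular G1 r1)
    (alpha : R) (halpha : 0 <= alpha <= 1)
    (lam : nat -> R) (hlam : ordered_eigenvalues (A_alpha alpha G1) lam) :
  let x : ratfun R := ratX in
  let a : ratfun R := ratC alpha in
  psi (A_alpha alpha (svjoin G1 G2)) x =
    (x - 2 * a) ^ (m1%:Z - n1%:Z)
    * psi (A_alpha alpha G2) (x - a * n1%:R)
    * (\prod_(2 <= i < n1.+1)
        (x ^+ 2 - a * (2 + r1%:R + n2%:R) * x
         + a * (a * r1%:R + r1%:R + 2 * a * n2%:R)
         - (1 - a) * ((1 - a) * r1%:R + ratC (lam i))))
    * (x ^+ 2 - a * (2 + r1%:R + n2%:R) * x
       - 2 * (r1%:R - 2 * a * r1%:R - a ^+ 2 * n2%:R)
       - n1%:R * (1 - a) ^+ 2 * (x - 2 * a)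
         * coronal (A_alpha alpha G2) (x - a * n1%:R)).
Proof.
move=> x a; subst n1 m1 n2.
have [lam_le chA] := hlam; have [G1_gt0 _] := hG1.
(* The order on eigenvalues lives in [R], so the first one is identified before passing to rational
   functions. *)
have lam1 := largest_eigenvalue_regular G1_gt0 hr1 halpha hlam.
have <- : #|edge G1| = #|edges G1| by rewrite card_sig; apply: eq_card.
have yE : x - a * #|G1|%:R = tofrac ('X - (alpha * #|G1|%:R)%:P).
  by rewrite -ratX_sub_ratC rmorphM rmorph_nat.
have WE : map_mx (@ratC R) (A_alpha alpha G2) = A_alpha a G2 by rewrite A_alpha_map.
have detW : psi (A_alpha alpha G2) (x - a * #|G1|%:R)
    = \det ((x - a * #|G1|%:R)%:M - A_alpha a G2) by rewrite psi_det WE.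
rewrite detW /coronal WE psi_det A_alpha_map.
rewrite -(det_mxsub_inj _ (esym (card_svjoin G1 G2)) (@svjoin_index_inj G1 G2)).
rewrite (svjoin_block _ _ _ hr1).
apply: (@det_svjoin_block _ _ _ _ x a r1%:R (@ratC R \o lam) (A_alpha a G1)) => //.
- by rewrite (_ : 2 * a = ratC (2 * alpha)) ?ratX_sub_ratC_neq0 // rmorphM rmorph_nat.
(* The determinant of this block is [psi] of [A_alpha alpha G2] at a polynomial of degree 1, hence
   nonzero. *)
- by rewrite unitmxE unitfE -detW yE psi_neq0 // size_XsubC.
- rewrite (_ : 2 * a = ratC (2 * alpha)); last by rewrite rmorphM rmorph_nat.
  rewrite (_ : a * _ = ratC (alpha * (r1%:R + #|G2|%:R))).
    rewrite (_ : 2 * _ * _ = ratC (2 * (1 - alpha) ^+ 2 * r1%:R)).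
      exact: ratX_quadratic_neq0.
    by rewrite !rmorphM rmorphB rmorph1 !rmorph_nat.
  by rewrite rmorphM rmorphD !rmorph_nat.
(* With [D] the scalar [r1], both sides are [(1 - a) * r1] plus [1 - a] times the adjacency
   matrix. *)
- rewrite inc_mx_mul_tr; apply/matrixP=> i j; rewrite !mxE hr1.
  by case: (i == j); ring.
- exact: A_alpha_mul_const1.
- rewrite -A_alpha_map -map_char_poly chA rmorph_prod.
  by apply: eq_bigr => i _; rewrite /= map_polyXsubC.
- by rewrite /= lam1 rmorph_nat.
Qed.
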